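(* Assume that the offspring distribution $\mathcal{Q}$ has an exponentially decaying tail, that is, there exists $\delta>0$ such that $\sum_l Q_l\exp(\delta l)<\infty$. Then, conditional on $G_n$, $$V_n=O_P(\log n)\quad\text{if } d\ge 3,\qquad\text{and}\qquad V_n=O_P((\log n)^2)\quad\text{if } d=2.$$
   Context: Branching random walk: a nearest neighbor branching random walk on $\mathbb{Z}^d$ with offspring distribution $\mathcal{Q}=\{Q_l\}_{l\ge 0}$ evolves as follows: at each time $n=0,1,2,\dots$ every particle independently produces a random number of offspring with law $\mathcal{Q}$ (which replace it), and each offspring independently moves to a site chosen uniformly at random from the $2d+1$ sites at distance $\le 1$ from the location of its parent. Standing assumptions: $\mathcal{Q}$ has mean $1$ (criticality) and finite, positive variance $\sigma^2$; the process is started by a single particle at the origin at time $0$. Notation: $U_n(x)$ is the number of particles at site $x$ in generation $n$; $V_n=\max_{x\in\mathbb{Z}^d}U_n(x)$; $G_n$ is the event that the process survives to generation $n$ (at least one particle in generation $n$). For random variables $X_n$, positive reals $f(n)$ and events $H_n$ of positive probability: $X_n=O_P(f(n))$ given $H_n$ means that the conditional distributions of $X_n/f(n)$ given $H_n$ are tight. *)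

(* Defs.v *)
From HB Require Import structures.
From mathcomp Require Import all_boot all_order all_algebra.
From mathcomp Require Import all_classical all_reals all_analysis.

Set Implicit Arguments.
Unset Strict Implicit.
Unset Printing Implicit Defensive.

Import Order.TTheory GRing.Theory Num.Theory.
Import numFieldTopology.Exports numFieldNormedType.Exports.

Local Open Scope classical_set_scope.
Local Open Scope ring_scope.

Definition site (d : nat) : Type := 'rV[int]_d.
HB.instance Definition _ (d : nat) := GRing.Zmodule.copy (site d) 'rV[int]_d.
HB.instance Definition _ (d : nat) := isPointed.Build (site d) 0.
HB.instance Definition _ (d : nat) := @isMeasurable.Build
  default_measure_display (site d) discrete_measurable discrete_measurable0
  discrete_measurableC discrete_measurableU.

(* The l1 distance.  On Z^d it has the same balls of radius 1 as the Euclidean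
   distance: a site together with its 2d nearest neighbors. *)
Definition site_dist (d : nat) (x y : site d) : nat :=
  (\sum_(i < d) absz (x ord0 i - y ord0 i)%R)%N.

Section Offspring.
Context {R : realType}.
Implicit Type Q : nat -> R.

Definition is_distribution Q : Prop :=
  (forall l, 0 <= Q l) /\ (\sum_(0 <= l <oo) (Q l)%:E = 1)%E.

Definition distribution_mean Q : \bar R :=
  (\sum_(0 <= l <oo) (Q l * l%:R)%:E)%E.

Definition distribution_variance Q : \bar R :=
  (\sum_(0 <= l <oo)
     (Q l * (l%:R - fine (distribution_mean Q)) ^+ 2)%:E)%E.

Definition exponential_tail Q : Prop :=
  exists2 delta : R, 0 < delta &
    (\sum_(0 <= l <oo) (Q l * expR (delta * l%:R))%:E < +oo)%E.

End Offspring.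

Section Independence.
Context {R : realType} {dT : measure_display} {T : measurableType dT}.

Definition mutually_independent (P : probability T R) (I : choiceType)
    (F : I -> set (set T)) : Prop :=
  forall (s : seq I) (A : I -> set T),
    uniq s -> (forall i, i \in s -> F i (A i)) ->
    (P (\bigcap_(i in [set` s]) A i) = \prod_(i <- s) P (A i))%E.

End Independence.

(* Particles are named by Ulam-Harris labels: the root is [::] and the children
   of u are rcons u 0, rcons u 1, ..., rcons u (k - 1), where k is the number
   of offspring of u. *)
Definition label : choiceType := seq nat.

Section BranchingRandomWalk.
Context {R : realType} {dT : measure_display} {T : measurableType dT}.
Variables (P : probability T R) (d : nat).
(* step u is the displacement of the particle u from its parent; step [::] is
   never used, since the root is not displaced.  Both families are indexed by
   all labels, whether or not the particle is ever born. *)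
Variables (offspring : label -> {RV P >-> nat})
          (step : label -> {RV P >-> site d}).

Definition brw_sources (i : label + label) : set (set T) :=
  match i with
  | inl u => preimage_set_system setT (offspring u) measurable
  | inr u => preimage_set_system setT (step u) measurable
  end.

Record branching_random_walk (Q : nat -> R) : Prop := {
  brw_offspringE : forall u l,
    distribution P (offspring u) [set l] = (Q l)%:E ;
  brw_stepE : forall u (e : site d),
    distribution P (step u) [set e] =
      (if (site_dist e 0%R <= 1)%N then (2 * d + 1)%:R^-1 else 0)%:E ;
  brw_independent : mutually_independent P brw_sources }.

Fixpoint generation (w : T) (n : nat) : seq label :=
  if n is m.+1 then
    [seq rcons u j | u <- generation w m, j <- iota 0 (offspring u w)]
  else [:: [::]].

Definition position (w : T) (u : label) : site d :=
  \sum_(1 <= k < (size u).+1) step (take k u) w.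

Definition brw_U (n : nat) (x : site d) (w : T) : nat :=
  count (fun u => position w u == x) (generation w n).

Definition brw_V (n : nat) (w : T) : R :=
  sup (range (fun x : site d => (brw_U n x w)%:R)).

Definition survival (n : nat) : set T :=
  [set w | generation w n <> [::]].

(* The supremum defining V_n is a maximum. *)
Lemma brw_V_max (n : nat) (w : T) :
  (exists x, brw_V n w = (brw_U n x w)%:R) /\
  (forall x, (brw_U n x w)%:R <= brw_V n w).
Proof.
pose s := generation w n.
pose E : set R := range (fun x : site d => (brw_U n x w)%:R).
have ubU x : (brw_U n x w <= size s)%N by exact: count_size.
have [x0 maxx0] : exists x0, forall x, (brw_U n x w <= brw_U n x0 w)%N.
  pose p k := `[< exists x, brw_U n x w = k >].
  have exp : exists k, p k by exists (brw_U n 0 w); apply/asboolP; exists 0.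
  have ubp k : p k -> (k <= size s)%N by move=> /asboolP[x <-].
  have [k /asboolP[x0 <-] kmax] := ex_maxnP exp ubp.
  by exists x0 => x; apply: kmax; apply/asboolP; exists x.
suff VE : brw_V n w = (brw_U n x0 w)%:R.
  by split; [exists x0|move=> x; rewrite VE ler_nat].
have ubE : ubound E (brw_U n x0 w)%:R by move=> _ [x _ <-]; rewrite ler_nat.
apply/eqP; rewrite eq_le; apply/andP; split.
  by apply: ge_sup => //; exists (brw_U n x0 w)%:R; exists x0.
by apply: ub_le_sup; [exists (brw_U n x0 w)%:R|exists x0].
Qed.

End BranchingRandomWalk.

Section Tightness.
Context {R : realType} {dT : measure_display} {T : measurableType dT}.

Definition conditional_distribution (P : probability T R) (H : set T)
    (X : T -> R) (A : set R) : R :=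
  fine (P (X @^-1` A `&` H)) / fine (P H).

Definition tight (D : set nat) (mu : nat -> set R -> R) : Prop :=
  forall eps : R, 0 < eps ->
    exists2 K : set R, compact K & forall n, D n -> mu n (~` K) <= eps.

(* X_n = O_P(f n) given H_n, for n ranging over D; f is meant to be positive
   on D. *)
Definition bigO_P_given (P : probability T R) (D : set nat)
    (X : nat -> T -> R) (f : nat -> R) (H : nat -> set T) : Prop :=
  tight D (fun n =>
    conditional_distribution P (H n) (fun w => X n w / f n)).

End Tightness.

(* Main.v *)
Require Import Defs.
From HB Require Import structures.
From mathcomp Require Import all_boot all_order all_algebra.
From mathcomp Require Import all_classical all_reals all_analysis.
From mathcomp Require Import measurable_realfun.
From mathcomp Require Import ring lra zify.

Set Implicit Arguments.
Unset Strict Implicit.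
Unset Printing Implicit Defensive.

Import Order.TTheory GRing.Theory Num.Theory.
Import numFieldTopology.Exports numFieldNormedType.Exports.

Local Open Scope classical_set_scope.
Local Open Scope ring_scope.

(* Let A be the averaging operator of the step distribution and f the generating
   function of Q.  Revealing the tree generation by generation shows that
   E prod_(u in generation n) phi_0(X_u) <= phi_n(0) as soon as
   f(A phi_k) <= phi_(k+1); this needs only an upper bound
   f(1 + s) <= 1 + s + B s^2, valid for -1 <= s <= a by the exponential tail.
   - phi_k = 1 - c/(k+1) gives P(G_n) >= c/(n+1).
   - phi_k = 1 + lam_k eta A^k 1_x, with lam_0 = 1, bounds E (1 + eta)^U_n(x) by
     1 + 2 eta A^n 1_x(0), provided eta times the sum over k <= n of the heat
     kernel maxima is small.  That sum is O(1) if d >= 3 and O(log n) if d = 2,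
     so eta may be a constant, respectively c / log n.
   As A^n 1_x(0) sums to at most 1 over x, Markov's inequality and a union bound
   yield P(V_n >= m) <= 2 eta / ((1 + eta)^m - 1), which is o(1/n) for m a large
   multiple of (log n) / eta.  Given the number of steps in each coordinate
   direction, the coordinates of the walk are independent simple walks, bounded
   by central binomial coefficients; this controls the heat kernel. *)

(** * Revealing independent sources one at a time *)

Section Countable.
Context {R : realType} {V : countType}.

Lemma sum_pickle_inv (a : V -> R) N :
  \sum_(0 <= k < N) (if pickle_inv k is Some v then a v else 0) =
  \sum_(v <- pmap (@pickle_inv V) (iota 0 N)) a v.
Proof.
rewrite /index_iota subn0; elim: (iota 0 N) => [|k s IH] /=.
  by rewrite !big_nil.
by rewrite big_cons IH; case: (pickle_inv k) => [v|] /=; rewrite ?big_cons ?add0r.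
Qed.

Lemma uniq_pmap_pickle_inv N : uniq (pmap (@pickle_inv V) (iota 0 N)).
Proof. by apply: (pmap_uniq (@pickle_invK V)); exact: iota_uniq. Qed.

Lemma pickle_inv_inj k l v :
  @pickle_inv V k = Some v -> @pickle_inv V l = Some v -> k = l.
Proof.
move=> kv lv; have := @pickle_invK V k; have := @pickle_invK V l.
by rewrite kv lv /= => <- <-.
Qed.

(** Sums over finite sets of points stand in for a sum over all of [V]; codes that decode to nothing
    contribute zero. *)
Lemma nneseries_countable_le (a : V -> R) (t : (\bar R)^nat) (C : R) :
  (forall k, 0 <= t k)%E ->
  (forall k, t k <= (if pickle_inv k is Some v then a v else 0)%:E)%E ->
  (forall s, uniq s -> \sum_(v <- s) a v <= C) ->
  (\sum_(0 <= k <oo) t k <= C%:E)%E.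
Proof.
move=> t0 ta sC; apply: lime_le; first exact: is_cvg_nneseries.
apply: nearW => N; apply: (@le_trans _ _ (\sum_(0 <= k < N)
    (if pickle_inv k is Some v then a v else 0)%:E)%E).
  exact: lee_sum.
by rewrite sumEFin lee_fin sum_pickle_inv; apply: sC; exact: uniq_pmap_pickle_inv.
Qed.

End Countable.

Section Fibers.
Context {dT : measure_display} {T : measurableType dT} {V : countType}.
Variable X : T -> V.

(** Indexing by codes, with empty pieces for invalid ones, turns the level sets of [X] into a
    sequence, to which countable additivity applies. *)
Definition fiber k := if pickle_inv k is Some v then X @^-1` [set v] else set0.

Lemma trivIset_fiber : trivIset setT fiber.
Proof.
apply/trivIsetP => k l _ _ kl; apply/seteqP; split=> // w [].
rewrite /fiber; case kv : (pickle_inv k) => [v|] //.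
case lv : (pickle_inv l) => [v'|] //= Xk Xl.
by move/eqP: kl; apply; apply: (pickle_inv_inj kv); rewrite -Xk Xl lv.
Qed.

Lemma bigcup_fiber : \bigcup_k fiber k = setT.
Proof.
apply/seteqP; split => // w _; exists (pickle (X w)) => //.
by rewrite /fiber pickleK_inv.
Qed.

Hypothesis mX : forall v, measurable (X @^-1` [set v]).

Lemma measurable_fiber k : measurable (fiber k).
Proof. by rewrite /fiber; case: (pickle_inv k). Qed.

Lemma measurable_fun_fibers d2 (T2 : measurableType d2) (f : T -> T2)
    (g : V -> T -> T2) :
  (forall v w, X w = v -> f w = g v w) -> (forall v, measurable_fun setT (g v)) ->
  measurable_fun setT f.
Proof.
move=> fg mg; rewrite -bigcup_fiber; apply/measurable_fun_bigcup => [|k].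
  exact: measurable_fiber.
rewrite /fiber; case: (pickle_inv k) => [v|]; last exact: measurable_fun_set0.
apply: (eq_measurable_fun (g v)); last exact: measurable_funTS.
by move=> w; rewrite inE /= => /fg ->.
Qed.

End Fibers.

Section Exploration.
Context {R : realType} {dT : measure_display} {T : measurableType dT}.
Variables (P : probability T R) (I : choiceType) (F : I -> set (set T)).
Implicit Types (K : set I) (A : set T) (G : T -> R).
Local Open Scope ereal_scope.

(** When [P A > 0], this says that under the conditional law given [A] the sources in [K] remain
    independent with unchanged laws. *)
Definition independent_of K A :=
  forall (s : seq I) (B : I -> set T), uniq s ->
    (forall i, i \in s -> K i /\ F i (B i)) ->
    P (A `&` \bigcap_(i in [set` s]) B i) = P A * \prod_(i <- s) P (B i).

Lemma independent_ofS K K' A : K `<=` K' ->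
  independent_of K' A -> independent_of K A.
Proof.
by move=> KK' AK' s B us sB; apply: AK' => // i /sB[Ki FB]; split=> //; exact: KK'.
Qed.

Lemma independent_ofT K : mutually_independent P F -> independent_of K setT.
Proof.
move=> PF s B us sB; rewrite setTI probability_setT mul1e.
by apply: PF => // i /sB[].
Qed.

(** Conditioning on an event of source [i] spends that source and leaves those in [K] fresh: insert
    [C] at index [i] in the product formula for [A]. *)
Lemma independent_of_setI K i A C : ~ K i -> F i C ->
  independent_of (K `|` [set i]) A ->
  P (A `&` C) = P A * P C /\ independent_of K (A `&` C).
Proof.
move=> nKi FC AKi; have PAC : P (A `&` C) = P A * P C.
  have := AKi [:: i] (fun=> C) isT; rewrite set_cons1 bigcap_set1 big_seq1; apply.
  by move=> j; rewrite inE => /eqP ->; split => //; right.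
split=> // s B us sB.
pose B' j := if j == i then C else B j.
have nsi : i \notin s by apply/negP => /sB[/nKi].
have B'E j : j \in s -> B' j = B j.
  by move=> js; rewrite /B'; case: eqP => // ji; move: nsi; rewrite -ji js.
have := AKi (i :: s) B'; rewrite /= nsi us => /(_ isT).
have -> : [set` i :: s] = i |` [set` s].
  apply/seteqP; split => j /=; rewrite inE.
    by case/orP => [/eqP|]; [left|right].
  by case=> [->|->]; rewrite ?eqxx ?orbT.
have B'i : B' i = C by rewrite /B' eqxx.
rewrite bigcap_setU1 big_cons B'i.
have -> : \bigcap_(j in [set` s]) B' j = \bigcap_(j in [set` s]) B j.
  by apply: eq_bigcapr => j /= /B'E.
have -> : \prod_(j <- s) P (B' j) = \prod_(j <- s) P (B j).
  by rewrite big_seq [RHS]big_seq; apply: eq_bigr => j /B'E ->.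
rewrite setIA PAC muleA; apply.
move=> j; rewrite inE => /orP[/eqP ->|js].
  by rewrite B'i; split => //; right.
by rewrite B'E //; have [] := sB _ js; split => //; left.
Qed.

(* c bounds the conditional mean of G given any event that is independent of
   the sources in K. *)
Definition mean_bound K G (c : R) : Prop :=
  [/\ measurable_fun setT G, forall w, (0 <= G w)%R &
    forall A, measurable A -> independent_of K A ->
      \int[P]_(w in A) (G w)%:E <= c%:E * P A].

Lemma mean_boundS K K' G c : K `<=` K' -> mean_bound K G c -> mean_bound K' G c.
Proof.
move=> KK' [mG G0 Gc]; split=> // A mA /(independent_ofS KK'); exact: Gc.
Qed.

Lemma mean_bound1 K : mean_bound K (cst 1%R) 1%R.
Proof.
split=> // A mA _; first by rewrite (eq_integral (cst 1)) // integral_cst.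
Qed.

Lemma mean_boundZ K G (a c : R) : (0 <= a)%R ->
  mean_bound K G c -> mean_bound K (fun w => a * G w)%R (a * c)%R.
Proof.
move=> a0 [mG G0 Gc]; split=> [|w|A mA iA].
- by apply: measurable_funM => //; exact: measurable_cst.
- exact: mulr_ge0.
- under eq_integral do rewrite EFinM.
  rewrite ge0_integralZl_EFin //; first by rewrite EFinM -muleA lee_wpmul2l ?Gc.
  + by move=> w _; rewrite lee_fin.
  + by apply/measurable_EFinP; exact: measurable_funTS.
Qed.

(** On the level set [X = v] the variable [G] equals [G_ v], and intersecting [A] with this set
    keeps it independent of [K]; so the bounds [c v] may be averaged with the weights [p v]. *)
Lemma mean_bound_expose (V : countType) K i (X : T -> V) (p c : V -> R)
    (G : T -> R) (G_ : V -> T -> R) (C : R) :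
  ~ K i -> (forall v, F i (X @^-1` [set v])) ->
  (forall v, measurable (X @^-1` [set v])) ->
  (forall v, P (X @^-1` [set v]) = (p v)%:E) -> (forall v, 0 <= c v)%R ->
  (forall v w, X w = v -> G w = G_ v w) ->
  (forall v, mean_bound K (G_ v) (c v)) ->
  (forall s, uniq s -> \sum_(v <- s) p v * c v <= C)%R ->
  mean_bound (K `|` [set i]) G C.
Proof.
move=> nKi FX mX PX c0 GG_ GK sC.
have mG : measurable_fun setT G.
  by apply: (measurable_fun_fibers mX GG_) => v; have [] := GK v.
have G0 w : (0 <= G w)%R by rewrite (GG_ _ _ erefl); have [] := GK (X w).
split=> // A mA iA; have mAX k : measurable (A `&` fiber X k).
  by apply: measurableI => //; exact: measurable_fiber.
rewrite -[A in integral _ A _]setIT -(bigcup_fiber X) setI_bigcupr.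
rewrite ge0_integral_bigcup//; last 3 first.
- by apply/measurable_EFinP; exact: measurable_funTS.
- by move=> w _; rewrite lee_fin.
- exact/trivIset_setIl/trivIset_fiber.
have PAfin : P A \is a fin_num by rewrite fin_num_measure.
rewrite -[P A in leRHS]fineK // -EFinM.
apply: (nneseries_countable_le (a := fun v => fine (P A) * (p v * c v))%R).
- by move=> k; apply: integral_ge0 => w _; rewrite lee_fin.
- move=> k; rewrite /fiber; case: (pickle_inv k) => [v|]; last first.
    by rewrite setI0 integral_set0.
  have [PAX iAX] := independent_of_setI nKi (FX v) iA.
  have [_ G_0 Gc] := GK v.
  rewrite (eq_integral (fun w => (G_ v w)%:E)); last first.
    by move=> w; rewrite inE => -[_ /= /GG_ ->].
  apply: le_trans (Gc _ _ iAX) _; first exact: measurableI.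
  by rewrite PAX PX !EFinM fineK // muleC -muleA.
- move=> s us; rewrite -big_distrr /= mulrC ler_wpM2r ?fine_ge0 //.
  exact: sC.
Qed.

End Exploration.

(** * The branching walk and the averaging operator *)

Section Sums.
Context {R : numDomainType}.

Lemma ler_sum_subseq (V : eqType) (s1 s2 : seq V) (f : V -> R) :
  (forall v, 0 <= f v) -> uniq s1 -> {subset s1 <= s2} ->
  \sum_(v <- s1) f v <= \sum_(v <- s2) f v.
Proof.
move=> f0; elim: s1 s2 => [|x s1 IH] s2 /=; first by rewrite big_nil sumr_ge0.
move=> /andP[xs1 us1] s12; have xs2 : x \in s2 by rewrite s12 ?mem_head.
rewrite (perm_big _ (perm_to_rem xs2)) !big_cons lerD2l IH // => v vs1.
have := s12 v; rewrite inE vs1 orbT (perm_mem (perm_to_rem xs2)) inE => /(_ isT).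
by case: eqP => // vx; move: xs1; rewrite -vx vs1.
Qed.

End Sums.

Section Lattice.
Context {R : realType} {d : nat}.
Implicit Types (x y e : site d) (f g : site d -> R).

Definition dir (i : 'I_d) : site d := delta_mx ord0 i.

Definition neighbors : seq (site d) :=
  0 :: [seq dir i | i : 'I_d] ++ [seq - dir i | i : 'I_d].

Definition avg f y : R :=
  (2 * d + 1)%:R^-1 * \sum_(e <- neighbors) f (y + e).

Lemma avgE f y :
  avg f y = (2 * d + 1)%:R^-1 * (f y + \sum_i (f (y + dir i) + f (y - dir i))).
Proof.
by rewrite /avg /neighbors big_cons addr0 big_cat /= !big_image /= big_split.
Qed.

Lemma mem_neighbors e : (site_dist e 0%R <= 1)%N -> e \in neighbors.
Proof.
move=> e1; have [->|/eqP e0] := eqVneq e 0; first exact: mem_head.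
have [i ei0] : exists i, e ord0 i != 0.
  apply: contrapT => h; apply: e0; apply/rowP => i; rewrite mxE.
  by apply/eqP; apply: contrapT => /negP ei; apply: h; exists i.
have e1i : (`|e ord0 i| <= 1)%N /\ forall j, j != i -> e ord0 j = 0.
  move: e1; rewrite /site_dist (bigD1 i) //= mxE subr0 => e1; split.
    by apply: leq_trans e1; exact: leq_addr.
  move=> j ji; move: e1; rewrite (bigD1 j) //= mxE subr0 => e1.
  have {}ei0 : (0 < `|e ord0 i|)%N by rewrite absz_gt0.
  have : (`|e ord0 j| <= 0)%N by lia.
  by rewrite leqn0 absz_eq0 => /eqP.
have {e1i} [e1i e0j] := e1i.
have ei : e ord0 i = 1 \/ e ord0 i = -1 by lia.
have : e = dir i \/ e = - dir i.
  case: ei => ei; [left|right]; apply/rowP => j; rewrite !mxE eqxx /=;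
    by case: (eqVneq j i) => [->|/e0j ->] //=; rewrite oppr0.
rewrite inE mem_cat; case=> ->; apply/orP; right; apply/orP; [left|right].
  by apply: map_f; rewrite mem_enum.
by apply: (map_f (fun i => - dir i)); rewrite mem_enum.
Qed.

Lemma avg_ge0 f y : (forall x, 0 <= f x) -> 0 <= avg f y.
Proof. by move=> f0; rewrite mulr_ge0 ?invr_ge0 ?sumr_ge0. Qed.

Lemma ler_avg f g y : (forall x, f x <= g x) -> avg f y <= avg g y.
Proof. by move=> fg; rewrite ler_wpM2l ?invr_ge0 ?ler_sum. Qed.

Lemma avg_cst (c : R) y : avg (fun=> c) y = c.
Proof.
have d0 : (2 * d + 1)%:R != 0 :> R by rewrite addn1 pnatr_eq0.
rewrite avgE sumr_const card_ord -mulr_natr; move: d0; rewrite natrD natrM => d0.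
by field.
Qed.

Lemma avg_lin (a b : R) f y :
  avg (fun x => a + b * f x) y = a + b * avg f y.
Proof.
rewrite /avg big_split /= mulrDr -/(avg (fun=> a) y) avg_cst; congr (_ + _).
by rewrite -big_distrr /= mulrCA.
Qed.

Lemma avg_sum (V : Type) (s : seq V) (F : V -> site d -> R) y :
  avg (fun x => \sum_(v <- s) F v x) y = \sum_(v <- s) avg (F v) y.
Proof. by rewrite /avg exchange_big big_distrr. Qed.

(** Supplies the summation premise of [mean_bound_expose] for a step: every possible displacement
    occurs in [neighbors]. *)
Lemma sum_step_le (s : seq (site d)) f y : uniq s -> (forall x, 0 <= f x) ->
  \sum_(e <- s) (if (site_dist e 0%R <= 1)%N then (2 * d + 1)%:R^-1 else 0) *
    f (y + e)
  <= avg f y.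
Proof.
move=> us f0.
under eq_bigr do rewrite (fun_if (fun c => c * _)) mul0r.
rewrite -big_mkcond /= -big_distrr /= -big_filter ler_wpM2l ?invr_ge0 //.
apply: ler_sum_subseq => //; first exact: filter_uniq.
by move=> e; rewrite mem_filter => /andP[/mem_neighbors].
Qed.

End Lattice.

(** * Supersolutions bound the mean of a product over a generation *)

Section Subtrees.
Context {R : realType} {dT : measure_display} {T : measurableType dT}.
Variables (P : probability T R) (d : nat).
Variables (offspring : label -> {RV P >-> nat})
          (step : label -> {RV P >-> site d}).
Implicit Types (u v : label) (y : site d) (w : T).

(** The position [y] of [u] is an argument, so that the value depends on the sources below [u] alone
    and not on the path leading to [u]. *)
Fixpoint subtree_prod (phi : site d -> R) r u y w : R :=
  if r is r'.+1 then
    \prod_(j < offspring u w)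
      subtree_prod phi r' (rcons u j) (y + step (rcons u j) w) w
  else phi y.

Lemma position_rcons w u j :
  position step w (rcons u j) = position step w u + step (rcons u j) w.
Proof.
rewrite /position size_rcons big_nat_recr //= -(size_rcons u j) take_size.
apply: (congr1 (fun z => z + _)); rewrite !big_nat; apply: eq_bigr => k /andP[_ ku].
by rewrite -cats1 takel_cat //; move: ku; rewrite size_rcons.
Qed.

Lemma prod_generation phi w r m :
  \prod_(v <- generation offspring w m) subtree_prod phi r v (position step w v) w =
  \prod_(v <- generation offspring w (m + r)) phi (position step w v).
Proof.
elim: r m => [|r IH] m; first by rewrite addn0.
rewrite addnS -addSn -IH /= big_allpairs_dep /=; apply: eq_bigr => v _.
rewrite -(big_mkord xpredT (fun j => subtree_prod phi r (rcons v j)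
    (position step w v + step (rcons v j) w) w)).
by rewrite /index_iota subn0; under eq_bigr do rewrite -position_rcons.
Qed.

Lemma subtree_prodE phi w n :
  subtree_prod phi n [::] 0 w =
  \prod_(v <- generation offspring w n) phi (position step w v).
Proof.
by rewrite -[n in RHS]add0n -prod_generation /= big_seq1 /position big_nil.
Qed.

(** The step of the child [rcons u j] belongs to its branch, although it is not in
    [below (rcons u j)]: it is revealed just before the subtree of that child. *)
Definition branch u j (i : label + label) : Prop :=
  match i with inl v | inr v => prefix (rcons u j) v end.

(* The sources that determine the descendants of u relative to its position. *)
Definition below u (i : label + label) : Prop :=
  i = inl u \/ exists j, branch u j i.

Lemma branch_below u j i : below (rcons u j) i -> branch u j i.
Proof.
case=> [->|[k]] /=; first exact: prefix_refl.
by case: i => v /=; apply: prefix_trans; rewrite -[rcons _ k]cats1 prefix_prefix.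
Qed.

Lemma branch_disjoint u j k i : branch u j i -> branch u k i -> j = k.
Proof.
have H v : prefix (rcons u j) v -> prefix (rcons u k) v -> j = k.
  by rewrite !prefixE !size_rcons => /eqP -> /eqP /rcons_inj[].
by case: i => v; exact: H.
Qed.

Lemma branch_not_root u j : ~ branch u j (inl u).
Proof. by move=> /size_prefix; rewrite size_rcons ltnn. Qed.

Lemma below_not_step u : ~ below u (inr u).
Proof. by case=> // -[j] /size_prefix; rewrite size_rcons ltnn. Qed.

Variable Q : nat -> R.
Hypothesis brw : branching_random_walk offspring step Q.
Variable phi : nat -> site d -> R.
Hypothesis phi0 : forall r y, 0 <= phi r y.
Variable N : nat.
(** The supersolution condition f(A phi_r) <= phi_(r+1), stated through partial sums of the
    generating function f. *)
Hypothesis phiS : forall r y s, (r < N)%N -> uniq s ->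
  \sum_(l <- s) Q l * avg (phi r) y ^+ l <= phi r.+1 y.

Local Notation mean_bound := (mean_bound P (brw_sources offspring step)).

Lemma offspring_source u l :
  brw_sources offspring step (inl u) (offspring u @^-1` [set l]).
Proof. by exists [set l] => //; rewrite setTI. Qed.

Lemma step_source u e :
  brw_sources offspring step (inr u) (step u @^-1` [set e]).
Proof. by exists [set e] => //; rewrite setTI. Qed.

Lemma measurable_offspring u l : measurable (offspring u @^-1` [set l]).
Proof. by rewrite -[X in measurable X]setTI; exact: measurable_funPT. Qed.

Lemma measurable_step u e : measurable (step u @^-1` [set e]).
Proof. by rewrite -[X in measurable X]setTI; exact: measurable_funPT. Qed.

(** The extra factor [G], controlled by sources outside the subtree, carries the siblings already
    treated; this lets the induction handle the children one at a time. *)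
Lemma mean_bound_subtree r u y K G c : (r <= N)%N -> 0 <= c ->
  (forall i, K i -> ~ below u i) -> mean_bound K G c ->
  mean_bound (K `|` below u)
    (fun w => subtree_prod (phi 0) r u y w * G w) (phi r y * c).
Proof.
elim: r u y K G c => [|r IH] u y K G c rN c0 Ku GK /=.
  by apply: (@mean_boundS _ _ _ _ _ _ K); [exact: subsetUl|exact: mean_boundZ].
have av0 : 0 <= avg (phi r) y by exact: avg_ge0.
(* The first [k] children together with [G]; each child contributes one factor [avg (phi r) y]. *)
pose Gk k w := \prod_(j < k)
  subtree_prod (phi 0) r (rcons u j) (y + step (rcons u j) w) w * G w.
pose Kk k := K `|` [set i | exists2 j, (j < k)%N & branch u j i].
have GkK k : mean_bound (Kk k) (Gk k) (avg (phi r) y ^+ k * c).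
  elim: k => [|k IHk].
    rewrite expr0 mul1r; apply: (@mean_boundS _ _ _ _ _ _ K); first exact: subsetUl.
    by rewrite /Gk; under eq_fun do rewrite big_ord0 mul1r.
  pose v := rcons u k; pose c' := avg (phi r) y ^+ k * c.
  have c'0 : 0 <= c' by rewrite mulr_ge0 ?exprn_ge0.
  have dis i : Kk k i -> ~ branch u k i.
    case=> [Ki uki|[j jk uji] uki]; first by apply: (Ku _ Ki); right; exists k.
    by move: jk; rewrite (branch_disjoint uji uki) ltnn.
  (* With the displacement of child [k] frozen at [e], the induction hypothesis applies; exposing
     the step then averages [phi r (y + e)] over [e]. *)
  have IHe e := IH v (y + e) _ _ _ (ltnW rN) c'0
    (fun i Ki bi => dis i Ki (branch_below bi)) IHk.
  apply: (@mean_boundS _ _ _ _ _ _ (Kk k `|` below v `|` [set inr v])).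
    move=> i [[[Ki|[j jk uji]]|/branch_below bi]|->]; [by left|right..].
    - by exists j => //; exact: ltnW.
    - by exists k.
    - by exists k => //=; exact: prefix_refl.
  apply: (mean_bound_expose (X := step v)
    (p := fun e => if (site_dist e 0%R <= 1)%N then (2 * d + 1)%:R^-1 else 0)
    (c := fun e => phi r (y + e) * c')
    (G_ := fun e w => subtree_prod (phi 0) r v (y + e) w * Gk k w)) => //.
  - case=> [Ki|]; last exact: below_not_step.
    by apply: (dis _ Ki) => /=; exact: prefix_refl.
  - exact: step_source.
  - exact: measurable_step.
  - by move=> e; rewrite -(brw_stepE brw v e).
  - by move=> e; rewrite mulr_ge0.
  - by move=> e w <-; rewrite /Gk big_ord_recr /= mulrCA mulrA.
  - move=> s us; under eq_bigr do rewrite mulrA.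
    rewrite -big_distrl /= exprS -mulrA ler_wpM2r //.
    by apply: sum_step_le.
(* Once any fixed number of children is handled, exposing the offspring number averages the powers
   of [avg (phi r) y], and [phiS] concludes. *)
pose Kb := K `|` [set i | exists j, branch u j i].
apply: (@mean_boundS _ _ _ _ _ _ (Kb `|` [set inl u])).
  by move=> i [[Ki|[j uji]]|->]; [left|right; right; exists j|right; left].
apply: (mean_bound_expose (X := offspring u) (p := Q)
  (c := fun k => avg (phi r) y ^+ k * c) (G_ := Gk)) => //.
- by case=> [/Ku|[j /branch_not_root]] //; apply; left.
- exact: offspring_source.
- exact: measurable_offspring.
- by move=> l; rewrite -(brw_offspringE brw u l).
- by move=> l; rewrite mulr_ge0 ?exprn_ge0.
- by move=> l w <-.
- move=> k; apply: mean_boundS (GkK k) => i [Ki|[j _ uji]]; [left|right] => //.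
  by exists j.
- move=> s us; under eq_bigr do rewrite mulrA.
  by rewrite -big_distrl /= ler_wpM2r // phiS.
Qed.

Lemma mean_generation n : (n <= N)%N ->
  measurable_fun setT (fun w => \prod_(v <- generation offspring w n)
     phi 0 (position step w v)) /\
  (\int[P]_w (\prod_(v <- generation offspring w n)
     phi 0 (position step w v))%:E <= (phi n 0)%:E)%E.
Proof.
move=> nN.
have [|mG G0 Gn] := @mean_bound_subtree n [::] 0 set0 (cst 1) 1 nN ler01 _
  (mean_bound1 _ _ _).
  by [].
have GE w : subtree_prod (phi 0) n [::] 0 w * cst 1 w =
    \prod_(v <- generation offspring w n) phi 0 (position step w v).
  by rewrite mulr1 subtree_prodE.
split; first by under eq_fun do rewrite -GE.
under eq_integral do rewrite -GE.
apply: le_trans (Gn _ measurableT _) _.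
  by apply: independent_ofT; exact: brw_independent brw.
by rewrite probability_setT mule1 mulr1.
Qed.

End Subtrees.

(** * The offspring generating function *)

Section GeneratingFunction.
Context {R : realType}.
Implicit Types (s delta : R) (l : nat).

Lemma cvg_nneseries_fin (a : nat -> R) (A : R) : (forall l, 0 <= a l) ->
  (\sum_(0 <= l <oo) (a l)%:E = A%:E)%E ->
  \sum_(0 <= l < n) a l @[n --> \oo] --> A.
Proof.
move=> a0 aA; have : (\sum_(0 <= l < n) (a l)%:E)%E @[n --> \oo] --> A%:E.
  by rewrite -aA; apply: is_cvg_nneseries => l _ _; rewrite lee_fin.
move=> /fine_cvg; apply: cvg_trans; apply: near_eq_cvg; apply: nearW => n /=.
by rewrite sumEFin.
Qed.

Lemma expr1D_le_neg s l : -1 <= s <= 0 ->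
  (1 + s) ^+ l <= 1 + l%:R * s + l%:R ^+ 2 * s ^+ 2.
Proof.
move=> s0; elim: l => [|l IH]; first by rewrite expr0; lra.
have l0 : 0 <= l%:R :> R by [].
have s10 : 0 <= 1 + s by lra.
rewrite exprS; apply: le_trans (ler_wpM2l s10 IH) _; rewrite -natr1.
have : 0 <= (- s) * (l%:R * s) ^+ 2 by rewrite mulr_ge0 ?sqr_ge0 //; lra.
have : 0 <= l%:R * s ^+ 2 by rewrite mulr_ge0 ?sqr_ge0.
have := sqr_ge0 s.
nra.
Qed.

Lemma expr1D_le_pos s l : 0 <= s ->
  (1 + s) ^+ l <= 1 + l%:R * s + l%:R ^+ 2 * s ^+ 2 * (1 + s) ^+ l.
Proof.
move=> s0; elim: l => [|l IH]; first by rewrite expr0; lra.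
have l0 : 0 <= l%:R :> R by [].
have s10 : 0 <= 1 + s by lra.
have p1 : 1 <= (1 + s) ^+ l.+1 by rewrite exprn_ege1 // lerDl.
rewrite {1}exprS; apply: le_trans (ler_wpM2l s10 IH) _; rewrite -natr1.
rewrite mulrDr (mulrCA (1 + s)) -exprS; set X := (1 + s) ^+ l.+1 in p1 *.
have ls : 0 <= l%:R * s ^+ 2 * (X - 1) by rewrite !mulr_ge0 ?sqr_ge0 // subr_ge0.
have : 0 <= (l%:R + 1) * s ^+ 2 * X by rewrite !mulr_ge0 ?sqr_ge0 ?addr_ge0 //; lra.
nra.
Qed.

(** Half of the exponential weight absorbs l^2, at the cost 8 / delta^2; the other half absorbs (1 +
    s)^l, which is at most exp(delta l / 2) when 0 < s <= delta / 2. *)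
Lemma expr1D_le delta s l : 0 < delta -> -1 <= s <= delta / 2 ->
  (1 + s) ^+ l <=
  1 + l%:R * s + 8 / delta ^+ 2 * expR (delta * l%:R) * s ^+ 2.
Proof.
move=> d0 /andP[s1 sd]; have l0 : 0 <= l%:R :> R by [].
have dl0 : 0 <= delta * l%:R / 2 by rewrite !mulr_ge0 // ltW.
pose X := expR (delta * l%:R / 2).
have XX : expR (delta * l%:R) = X * X by rewrite -expRD -splitr.
have X1 : 1 <= X by rewrite -expR0 ler_expR.
have l2X : l%:R ^+ 2 <= 8 / delta ^+ 2 * X.
  have := expR_ge1Dxn 1 dl0; rewrite -/X => H.
  have d20 : 0 < delta ^+ 2 by rewrite exprn_gt0.
  rewrite mulrAC ler_pdivlMr //; move: H.
  have -> : (2`!)%:R = 2 :> R by [].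
  by have := sqr_ge0 l%:R; nra.
apply: (@le_trans _ _ (1 + l%:R * s + l%:R ^+ 2 * X * s ^+ 2)); last first.
  rewrite lerD2l ler_wpM2r ?sqr_ge0 // XX mulrA ler_wpM2r //; lra.
have [s0|s0] := leP s 0.
  apply: le_trans (expr1D_le_neg _ _) _; first by rewrite s1.
  by rewrite lerD2l ler_wpM2r ?sqr_ge0 // ler_peMr ?sqr_ge0.
apply: le_trans (expr1D_le_pos _ (ltW s0)) _.
rewrite lerD2l mulrAC ler_wpM2r ?sqr_ge0 // ler_wpM2l ?sqr_ge0 //.
apply: (@le_trans _ _ (expR s ^+ l)).
  by rewrite lerXn2r ?nnegrE ?expR_ge0 ?expR_ge1Dx //; lra.
have : 0 <= (delta / 2 - s) * l%:R by rewrite mulr_ge0 // subr_ge0.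
by rewrite -expRM_natl ler_expR; lra.
Qed.

(** Finite lists of distinct offspring numbers match the premise of [mean_bound_expose]; the
    coefficient 1 of [s] reflects criticality. *)
Definition quadratic_genfun_bound (Q : nat -> R) (a B : R) : Prop :=
  forall s (ls : seq nat), -1 <= s <= a -> uniq ls ->
    \sum_(l <- ls) Q l * (1 + s) ^+ l <= 1 + s + B * s ^+ 2.

(** Sum [expr1D_le] against [Q]: the total mass and the mean give 1 + s, the exponential moment
    gives the quadratic term. *)
Lemma generating_function_le (Q : nat -> R) :
  is_distribution Q -> distribution_mean Q = 1%E -> exponential_tail Q ->
  exists2 a : R, 0 < a & exists2 B : R, 0 < B &
    quadratic_genfun_bound Q a B.
Proof.
move=> [Q0 Q1] mQ [delta d0 Qd]; exists (delta / 2); first lra.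
have [E QE] : exists E : R,
    (\sum_(0 <= l <oo) (Q l * expR (delta * l%:R))%:E = E%:E)%E.
  exists (fine (\sum_(0 <= l <oo) (Q l * expR (delta * l%:R))%:E)%E).
  rewrite fineK // ge0_fin_numE //; apply: nneseries_ge0 => l _ _.
  by rewrite lee_fin mulr_ge0 ?expR_ge0.
have c0 := cvg_nneseries_fin Q0 Q1.
have c1 : \sum_(0 <= l < n) Q l * l%:R @[n --> \oo] --> (1 : R).
  by apply: cvg_nneseries_fin => // l; rewrite mulr_ge0.
have c2 : \sum_(0 <= l < n) Q l * expR (delta * l%:R) @[n --> \oo] --> E.
  by apply: cvg_nneseries_fin => // l; rewrite mulr_ge0 ?expR_ge0.
pose K : R := 8 / delta ^+ 2.
have K0 : 0 < K by rewrite divr_gt0 ?exprn_gt0.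
have E0 : 0 <= E.
  have : (0 <= E%:E)%E.
    by rewrite -QE; apply: nneseries_ge0 => l _ _; rewrite lee_fin mulr_ge0 ?expR_ge0.
  by rewrite lee_fin.
(* The added 1 ensures positivity, as [E] is only known to be nonnegative here. *)
exists (K * E + 1); first by rewrite ltr_wpDl // mulr_ge0 // ltW.
move=> s ls sd us.
pose b l := Q l * (1 + l%:R * s + K * expR (delta * l%:R) * s ^+ 2).
have Qb l : Q l * (1 + s) ^+ l <= b l by rewrite ler_wpM2l // expr1D_le.
have b0 l : 0 <= b l.
  by apply: le_trans (Qb l); rewrite mulr_ge0 ?exprn_ge0 //; lra.
have cb : \sum_(0 <= l < n) b l @[n --> \oo] --> (1 + 1 * s + E * (K * s ^+ 2) : R).
  have -> : (fun n => \sum_(0 <= l < n) b l) =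
    (fun n => \sum_(0 <= l < n) Q l + (\sum_(0 <= l < n) Q l * l%:R) * s +
      (\sum_(0 <= l < n) Q l * expR (delta * l%:R)) * (K * s ^+ 2)).
    apply: funext => n; rewrite !big_distrl /= -!big_split /=.
    by apply: eq_bigr => l _; rewrite /b; ring.
  by apply: cvgD; [apply: cvgD => //|]; apply: cvgMl.
apply: (@le_trans _ _ (\sum_(0 <= l < (\max_(l <- ls) l).+1) b l)).
  apply: le_trans (ler_sum _ (fun l _ => Qb l)) _.
  apply: ler_sum_subseq => // l lls; rewrite mem_index_iota /= ltnS.
  by rewrite (big_rem l) //= leq_maxl.
apply: (@le_trans _ _ (1 + 1 * s + E * (K * s ^+ 2))); last first.
  by have := sqr_ge0 s; nra.
rewrite -(cvg_lim (@Rhausdorff R) cb).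
apply: (nondecreasing_cvgn_le (u_ := fun n => \sum_(0 <= l < n) b l)).
  apply/nondecreasing_seqP => n; rewrite big_nat_recr //=.
  by rewrite lerDl.
by apply/cvg_ex; eexists; exact: cb.
Qed.

End GeneratingFunction.

(** * Heat kernel bounds *)

Section CentralBinomial.
Local Open Scope nat_scope.

Lemma leq_bin_mid a j : 'C(a, j) <= 'C(a, a./2).
Proof.
have up i : i.*2.+1 <= a -> 'C(a, i) <= 'C(a, i.+1).
  move=> ia; rewrite -(leq_pmul2l (ltn0Sn i)) mul_bin_left leq_mul2r.
  by apply/orP; right; lia.
have low k : k <= a./2 -> 'C(a, a./2 - k) <= 'C(a, a./2).
  elim: k => [|k IH] ka; first by rewrite subn0.
  apply: leq_trans (IH (ltnW ka)); rewrite (_ : a./2 - k = (a./2 - k.+1).+1); last by lia.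
  by apply: up; lia.
have [ja|aj] := leqP j a./2; first by rewrite -(subKn ja) low ?leq_subr.
have [ja|ja] := leqP j a; last by rewrite bin_small.
rewrite -bin_sub // (_ : a - j = a./2 - (a./2 - (a - j))); last by lia.
by rewrite low ?leq_subr.
Qed.

Lemma central_binS m : m.+1 * 'C(m.+1.*2, m.+1) = 2 * m.*2.+1 * 'C(m.*2, m).
Proof.
have := mul_bin_diag m.*2.+2 m; have := mul_bin_diag m.*2.+1 m; rewrite /= doubleS.
rewrite (_ : 'C(m.*2.+1, m.+1) = 'C(m.*2.+1, m)); first by nia.
by rewrite -bin_sub; [congr 'C(_, _); lia|lia].
Qed.

(** By induction: the left side grows by the factor 4 (2m+1)(2m+3) / (m+1)^2, which is at most 16
    because (2m+1)(2m+3) <= (2m+2)^2. *)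
Lemma central_bin_le m : 'C(m.*2, m) ^ 2 * m.*2.+1 <= 16 ^ m.
Proof.
elim: m => [|m IH] //; have := central_binS m.
set y := 'C(m.+1.*2, m.+1); move: ('C(m.*2, m)) IH => x IH yx.
rewrite -(leq_pmul2l (m := m.+1 ^ 2)) ?expn_gt0 //.
rewrite mulnA -expnMn yx [16 ^ _]expnS.
apply: (@leq_trans (4 * m.*2.+1 * m.+1.*2.+1 * 16 ^ m)); last first.
  by rewrite mulnA leq_mul2r; apply/orP; right; rewrite expnS expn1; nia.
apply: leq_trans (leq_mul (leqnn (4 * m.*2.+1 * m.+1.*2.+1)) IH).
by rewrite !expnS expn0 !muln1; lia.
Qed.

Lemma bin_sqr_le a j : 'C(a, j) ^ 2 * a.+1 <= 4 ^ a.
Proof.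
apply: (@leq_trans ('C(a, a./2) ^ 2 * a.+1)).
  by rewrite leq_mul2r leq_exp2r // leq_bin_mid orbT.
move: (esym (odd_double_half a)); move: (a./2) (odd a) => m [] -> {a}; last first.
  by rewrite !add0n -[in 4 ^ _]mul2n expnM central_bin_le.
(* The odd row reduces to the next even one, whose central entry is twice the middle entry of the
   odd row. *)
rewrite !add1n; have := central_bin_le m.+1.
have -> : 'C(m.+1.*2, m.+1) = 2 * 'C(m.*2.+1, m).
  rewrite doubleS binS -[in X in X + _]bin_sub; last by lia.
  by rewrite (_ : m.*2.+1 - m.+1 = m); lia.
rewrite [16 ^ _]expnS [4 ^ _]expnS -[in 4 ^ _]mul2n expnM.
set z := (4 ^ 2) ^ m; rewrite expnMn; nia.
Qed.

End CentralBinomial.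

(** * One-dimensional simple random walk *)

Section SimpleWalk.
Context {R : realType}.

Fixpoint srw (a : nat) (k : int) : R :=
  if a is a'.+1 then (srw a' (k - 1) + srw a' (k + 1)) / 2 else (k == 0)%:R.

Lemma srw_ge0 a k : 0 <= srw a k.
Proof. by elim: a k => [|a IH] k //=; rewrite divr_ge0 ?addr_ge0. Qed.

(** Here [j] counts the upward steps; Pascal's rule gives the induction. *)
Lemma srw_bin a :
  (forall j : nat, srw a (2 * j%:Z - a%:Z) = 'C(a, j)%:R / 2 ^+ a) /\
  (forall k, (forall j : nat, k != 2 * j%:Z - a%:Z) -> srw a k = 0).
Proof.
elim: a => [|a [IHj IH0]].
  split=> [j|k k0]; rewrite [srw 0 _]/srw; last first.
    by have := k0 0%N; rewrite mulr0 subr0 => /negbTE ->.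
  rewrite subr0 bin0n expr0 divr1 (_ : (_ == 0) = (j == 0%N)) //.
  by apply/eqP/eqP; lia.
have ah (x : R) : x / 2 ^+ a / 2 = x / 2 ^+ a.+1 by rewrite exprSr invfM mulrA.
split=> [[|j]|k kj] /=.
- rewrite IH0; last by move=> j; apply/eqP; lia.
  rewrite (_ : _ + 1 = 2 * 0%:Z - a%:Z); last by lia.
  by rewrite IHj add0r !bin0 ah.
- rewrite (_ : _ - 1 = 2 * j%:Z - a%:Z); last by lia.
  rewrite (_ : _ + 1 = 2 * j.+1%:Z - a%:Z); last by lia.
  by rewrite !IHj -mulrDl ah binS natrD addrC.
- rewrite !IH0 ?addr0 ?mul0r // => j; apply/eqP => kE.
    by have /eqP := kj j; lia.
  by have /eqP := kj j.+1; lia.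
Qed.

Lemma srw_le a k : srw a k <= (Num.sqrt a.+1%:R)^-1.
Proof.
have [srwj srw0] := srw_bin a.
have s0 : 0 < Num.sqrt (a.+1%:R : R) by rewrite sqrtr_gt0 ltr0Sn.
have [[j ->]|nk] := pselect (exists j : nat, k = 2 * j%:Z - a%:Z); last first.
  rewrite srw0 ?invr_ge0 ?sqrtr_ge0 // => j; apply/eqP => kj; apply: nk.
  by exists j.
rewrite srwj -[leRHS]mul1r ler_pdivlMr // mulrAC ler_pdivrMr ?exprn_gt0 // mul1r.
rewrite -(@ler_pXn2r _ 2) ?nnegrE ?mulr_ge0 ?exprn_ge0 ?sqrtr_ge0 //.
rewrite exprMn sqr_sqrtr ?ler0n // -exprM mulnC exprM -!natrX -natrM.
by rewrite ler_nat; exact: bin_sqr_le.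
Qed.

End SimpleWalk.

(** * The lazy walk as a mixture of products of simple walks *)

Section Walk.
Context {R : realType} {d : nat}.
Implicit Types (x y e : site d) (f : site d -> R) (a : 'I_d -> nat).

Definition walk n f : site d -> R := iter n avg f.

Definition site_indic x y : R := (y == x)%:R.

Lemma walk_ge0 n f y : (forall x, 0 <= f x) -> 0 <= walk n f y.
Proof. by move=> f0; elim: n y => [|n IH] y //=; exact: avg_ge0. Qed.

Lemma ler_walk n f g y : (forall x, f x <= g x) -> walk n f y <= walk n g y.
Proof. by move=> fg; elim: n y => [|n IH] y //=; exact: ler_avg. Qed.

Lemma walk_sum n (V : Type) (s : seq V) (F : V -> site d -> R) y :
  walk n (fun x => \sum_(v <- s) F v x) y = \sum_(v <- s) walk n (F v) y.
Proof.
elim: n y => [//|n IH] y /=; rewrite -avg_sum.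
by congr (avg _ y); apply: funext.
Qed.

Lemma walk_shift n f x y : walk n (fun z => f (z - x)) y = walk n f (y - x).
Proof.
elim: n y => [//|n IH] y /=; rewrite /avg; congr (_ * _); apply: eq_bigr => e _.
by rewrite -/(walk n _) IH addrAC.
Qed.

Lemma walk_avg_comb n f (g : 'I_d -> site d -> R) (c : R) y :
  walk n (fun x => c * (f x + 2 * \sum_i g i x)) y =
  c * (walk n f y + 2 * \sum_i walk n (g i) y).
Proof.
elim: n y => [//|n IH] y /=; rewrite -avg_sum -!/(walk n _).
rewrite (_ : walk n _ = fun x => c * (walk n f x + 2 * \sum_i walk n (g i) x));
  last exact: funext.
rewrite /avg !big_distrr /= -big_split /= big_distrr /=.
apply: eq_bigr => e _; ring.
Qed.

Lemma walk_cst1 n y : walk n (fun=> 1) y = 1.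
Proof.
elim: n y => [//|n IH] y /=; rewrite -[RHS](avg_cst 1 y).
by congr (avg _ y); apply: funext => x; exact: IH.
Qed.

(** The indicators of distinct sites sum to at most 1, and averaging preserves order and
    constants. *)
Lemma sum_walk_indic_le1 n (s : seq (site d)) y : uniq s ->
  \sum_(x <- s) walk n (site_indic x) y <= 1.
Proof.
move=> us; rewrite -walk_sum -[leRHS](walk_cst1 n y); apply: ler_walk => z.
rewrite /site_indic -natr_sum -[1]/(1%:R) ler_nat.
rewrite (eq_bigr (fun x => pred1 z x : nat)); last by move=> x _; rewrite /= eq_sym.
by rewrite -big_mkcond sum1_count count_uniq_mem // leq_b1.
Qed.

(* The law of the walk given that coordinate i was chosen a i times. *)
Definition srw_prod a x : R := \prod_i srw (a i) (x ord0 i).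

Definition incr a (i j : 'I_d) : nat := (a j + (j == i))%N.

Lemma srw_prod_indic x y : site_indic x y = srw_prod (fun=> 0%N) (y - x).
Proof.
rewrite /site_indic /srw_prod; have [->|/eqP yx] := eqVneq y x.
  by rewrite big1 // => i _; rewrite /= !mxE subrr eqxx.
have [i yxi] : exists i, y ord0 i != x ord0 i.
  apply: contrapT => h; apply: yx; apply/rowP => i.
  by apply/eqP; apply: contrapT => /negP ei; apply: h; exists i.
by rewrite (bigD1 i) //= !mxE subr_eq0 (negbTE yxi) mul0r.
Qed.

(** The two opposite moves along coordinate [i] together perform one more step of the simple walk in
    that coordinate, whence the factor 2; the other factors do not change. *)
Lemma avg_srw_prod a y :
  avg (srw_prod a) y =
  (2 * d + 1)%:R^-1 * (srw_prod a y + 2 * \sum_i srw_prod (incr a i) y).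
Proof.
rewrite avgE big_distrr /=; congr (_ * (_ + _)); apply: eq_bigr => i _.
rewrite /srw_prod !(bigD1 (P := xpredT) i) //= /incr eqxx addn1 /= !mxE !eqxx /=.
set p := \prod_(j | _) _; set p1 := \prod_(j | _) _; set p2 := \prod_(j | _) _.
have -> : p = p2.
  apply: eq_bigr => j ji; rewrite !mxE (negbTE ji) addr0.
  by rewrite addn0.
have -> : p1 = p2.
  apply: eq_bigr => j ji; rewrite !mxE (negbTE ji) subr0.
  by rewrite addn0.
by field.
Qed.

(** A comparison principle: averaging moves the counts [a] at random, so any supersolution [Psi] of
    that recursion dominates, and the multinomial law of the counts is never computed. *)
Lemma walk_srw_prod_le (Psi : nat -> ('I_d -> nat) -> R) :
  (forall a y, srw_prod a y <= Psi 0%N a) ->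
  (forall n a, (2 * d + 1)%:R^-1 * (Psi n a + 2 * \sum_i Psi n (incr a i))
     <= Psi n.+1 a) ->
  forall n a y, walk n (srw_prod a) y <= Psi n a.
Proof.
move=> P0 PS; elim=> [|n IH] a y; first exact: P0.
apply: le_trans (PS n a).
rewrite /walk iterSr -/(walk n _).
rewrite (_ : avg (srw_prod a) = fun y => (2 * d + 1)%:R^-1 *
  (srw_prod a y + 2 * \sum_i srw_prod (incr a i) y)); last first.
  by apply: funext => z; exact: avg_srw_prod.
rewrite walk_avg_comb ler_wpM2l ?invr_ge0 // lerD // ler_wpM2l // ler_sum //.
Qed.

End Walk.

(** * The power y^(-p/2) as a supersolution *)

Section Decay.
Context {R : realType}.
Implicit Types (y q : R) (p : nat).

Definition decay p y : R := (Num.sqrt y)^-1 ^+ p.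

Lemma decay_ge0 p y : 0 <= decay p y.
Proof. by rewrite exprn_ge0 ?invr_ge0 ?sqrtr_ge0. Qed.

Lemma decayM p y z : 0 <= y -> decay p (y * z) = decay p y * decay p z.
Proof. by move=> y0; rewrite /decay sqrtrM // invfM exprMn. Qed.

Lemma ler_decay p y z : 0 < y -> y <= z -> decay p z <= decay p y.
Proof.
move=> y0 yz; have z0 := lt_le_trans y0 yz.
rewrite lerXn2r ?nnegrE ?invr_ge0 ?sqrtr_ge0 //.
by rewrite lef_pV2 ?posrE ?sqrtr_gt0 // ler_sqrt // ltW.
Qed.

Lemma decay2 y : 0 <= y -> decay 2 y = y^-1.
Proof. by move=> y0; rewrite /decay exprVn sqr_sqrtr. Qed.

(** The function y^(2 - p/2) is nondecreasing since p <= 4. *)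
Lemma decay_shift_le p y q : (2 <= p <= 4)%N -> 0 < y -> 0 <= q ->
  decay p y * y ^+ 2 <= decay p (y + q) * (y + q) ^+ 2.
Proof.
move=> p24 y0 q0; have z0 : 0 < y + q by rewrite ltr_pwDl.
have E z : 0 < z -> decay p z * z ^+ 2 = Num.sqrt z ^+ (4 - p).
  move=> z0'; have s0 : Num.sqrt z ^+ p != 0 by rewrite expf_neq0 // gt_eqF ?sqrtr_gt0.
  have -> : z ^+ 2 = Num.sqrt z ^+ (4 - p) * Num.sqrt z ^+ p.
    rewrite -exprD subnK; last by lia.
    by rewrite (_ : 4 = 2 * 2)%N // exprM sqr_sqrtr // ltW.
  by rewrite /decay exprVn mulrC mulfK.
rewrite !E // lerXn2r ?nnegrE ?sqrtr_ge0 // ler_sqrt ?lerDl //; exact: ltW.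
Qed.

(** The function y^(1 - p/2) is nonincreasing since p >= 2. *)
Lemma decayS_le p y : (2 <= p)%N -> 0 < y ->
  decay p (y + 1) * (y + 1) <= decay p y * y.
Proof.
move=> p2 y0; have E z : 0 < z -> decay p z * z = decay (p - 2) z.
  move=> z0; rewrite -{1}(subnK p2) /decay exprD -mulrA -[X in _ * (X * _)]/(decay 2 z).
  by rewrite decay2 ?mulVf ?mulr1 ?gt_eqF // ltW.
by rewrite !E ?ler_decay ?lerDl // ltr_pwDl.
Qed.

(* Jensen goes the other way, but a shift by q / 6 instead of the mean q
   leaves enough room. *)
Lemma decay_supersolution p y q : (2 <= p <= 4)%N -> 1 <= y -> 0 < q <= 1 ->
  (1 - q) * decay p y + q * decay p (y + 1) <= decay p (y + q / 6).
Proof.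
move=> p24 y1 /andP[q0 q1]; have y0 : 0 < y by lra.
have /andP[p2 p4] := p24.
have q60 : 0 <= q / 6 by lra.
have := decayS_le p2 y0; have := decay_shift_le p24 y0 q60.
have := decay_ge0 p y.
set g := decay p y; set g1 := decay p (y + 1); set h := decay p (y + q / 6).
move=> g0 gh g1g.
have z0 : 0 < (y + q / 6) ^+ 2 by apply: exprn_gt0; lra.
rewrite -(ler_pM2r z0).
apply: le_trans gh.
have z1 : 0 < y + 1 by lra.
rewrite -(ler_pM2r z1).
have : q * (g1 * (y + 1)) * (y + q / 6) ^+ 2 <= q * (g * y) * (y + q / 6) ^+ 2.
  by apply: ler_wpM2r; [apply: exprn_ge0; lra|apply: ler_wpM2l => //; exact: ltW].
(* The two monotonicity facts reduce the claim to (y + 1 - q)(y + q/6)^2 <= y^2 (y + 1). To first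
   order in q this is (y + 1) / 3 <= y, which has room as y >= 1. *)
have : g * (((1 - q) * (y + 1) + q * y) * (y + q / 6) ^+ 2) <= g * (y ^+ 2 * (y + 1)).
  apply: ler_wpM2l => //.
  have -> : (1 - q) * (y + 1) + q * y = y + 1 - q by ring.
  have : 0 <= q * (y - 1) * y by rewrite !mulr_ge0 //; lra.
  have : 0 <= q * (y - 1) by rewrite !mulr_ge0 //; lra.
  have : 0 <= q * (1 - q) * y by rewrite !mulr_ge0 //; lra.
  have : 0 <= q * (1 - q) by rewrite !mulr_ge0 //; lra.
  have : 0 <= q * q * y by rewrite !mulr_ge0 //; lra.
  have : 0 <= q * q * q by rewrite !mulr_ge0 //; lra.
  have : 0 <= q * q * (1-q) by rewrite !mulr_ge0 //; lra.
  nra.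
nra.
Qed.

End Decay.

(** * The heat kernel and its sum over time *)

Section HeatKernel.
Context {R : realType}.

(** The largest factor z satisfies z^d <= z^p. Passing to a sum decouples the coordinates, leaving a
    one-dimensional recursion for each. *)
Lemma prod_le_sum_expr (d p : nat) (z : 'I_d -> R) : (p <= d)%N -> (0 < d)%N ->
  (forall i, 0 <= z i <= 1) -> \prod_i z i <= \sum_i z i ^+ p.
Proof.
move=> pd d0 z01; pose i0 : 'I_d := Ordinal d0.
pose i := [arg max_(j > i0) z j]%O.
have zi j : z j <= z i by rewrite /i; case: arg_maxP => // k _; exact.
have /andP[zi0 zi1] := z01 i.
apply: (@le_trans _ _ (z i ^+ d)).
  rewrite -[X in z i ^+ X](card_ord d) -prodr_const; apply: ler_prod => j _.
  by have /andP[-> _] := z01 j; rewrite zi.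
apply: (@le_trans _ _ (z i ^+ p)); first exact: ler_wiXn2l.
rewrite (bigD1 i) //= lerDl sumr_ge0 // => j _; apply: exprn_ge0.
by have /andP[] := z01 j.
Qed.

(** Of order n^(-p/2). A given coordinate moves with probability 2 / (2d+1); the 6 is the loss in
    [decay_supersolution], and the factor d comes from [prod_le_sum_expr]. *)
Definition heat_bound (d p n : nat) : R :=
  d%:R * decay p (2 / (2 * d + 1)%:R / 6 * n%:R + 1).

Lemma walk_indic_le (d p n : nat) (x y : site d) : (2 <= p <= 4)%N -> (p <= d)%N ->
  walk n (site_indic x) y <= heat_bound d p n.
Proof.
move=> p24 pd; have d0 : (0 < d)%N by lia.
have D0 : 0 < (2 * d + 1)%:R :> R by rewrite addn1 ltr0Sn.
pose q : R := 2 / (2 * d + 1)%:R.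
have q0 : 0 < q by rewrite divr_gt0.
have q1 : q <= 1 by rewrite ler_pdivrMr // mul1r ler_nat; lia.
have -> : site_indic x = fun y => srw_prod (fun=> 0%N) (y - x) :> R.
  by apply: funext => z; exact: srw_prod_indic.
rewrite walk_shift.
(* Each step raises the count [a i] with probability q, so [decay_supersolution] applies to every
   summand separately. *)
pose Psi n (a : 'I_d -> nat) : R := \sum_i decay p (q / 6 * n%:R + (a i).+1%:R).
have -> : heat_bound d p n = Psi n (fun=> 0%N).
  by rewrite /Psi /heat_bound sumr_const card_ord mulr_natl.
apply: walk_srw_prod_le => {n x y} [a y|n a].
  rewrite /Psi; under eq_bigr do rewrite mulr0 add0r.
  apply: (@le_trans _ _ (\prod_i (Num.sqrt (a i).+1%:R)^-1)).
    by apply: ler_prod => i _; rewrite srw_ge0 srw_le.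
  apply: prod_le_sum_expr => // i; rewrite invr_ge0 sqrtr_ge0 /=.
  by rewrite invf_le1 ?sqrtr_gt0 ?ltr0Sn // -[leLHS]sqrtr1 ler_sqrt ?ltr0Sn // ler1n.
pose Y i : R := q / 6 * n%:R + (a i).+1%:R.
have incrE i j : q / 6 * n%:R + (incr a j i).+1%:R = Y i + (i == j)%:R :> R.
  by rewrite /Y /incr -addSn natrD addrA.
have YS i : q / 6 * n.+1%:R + (a i).+1%:R = Y i + q / 6.
  by rewrite /Y -[n.+1%:R]natr1; ring.
rewrite /Psi; under [X in _ <= X]eq_bigr do rewrite YS.
under [X in 2 * X]eq_bigr do under eq_bigr do rewrite incrE.
rewrite exchange_big /= big_distrr /= -big_split /= big_distrr /=.
apply: ler_sum => i _; rewrite -/(Y i).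
rewrite (bigD1 i) //= eqxx (eq_bigr (fun=> decay p (Y i))); last first.
  by move=> j; rewrite eq_sym => /negbTE ->; rewrite addr0.
rewrite sumr_const (_ : #|_| = d.-1); last first.
  by rewrite cardC1 card_ord.
have Y1 : 1 <= Y i.
  rewrite /Y -[(a i).+1%:R]natr1 addrA lerDr addr_ge0 // mulr_ge0 //.
  by rewrite divr_ge0 // ltW.
apply: le_trans (decay_supersolution p24 Y1 _); last by rewrite q0.
(* Staying put and the d - 1 other directions together have probability 1 - q. *)
rewrite le_eqVlt; apply/orP; left; apply/eqP.
rewrite -mulr_natr /q; move: D0; rewrite natrD natrM.
have -> : d%:R = d.-1%:R + 1 :> R by rewrite natr1 prednK.
by move=> D0; field; rewrite gt_eqF.
Qed.

Lemma heat_bound_ge0 d p n : 0 <= heat_bound d p n.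
Proof. by rewrite mulr_ge0 ?decay_ge0. Qed.

(** The terms 1 / (k+2) <= ln (k+2) - ln (k+1) telescope to ln (n+1), and n + 1 <= n^2 for n >=
    2. *)
Lemma sum_decay2_le n : (2 <= n)%N ->
  \sum_(0 <= k < n) decay 2 (k.+2%:R : R) <= 2 * ln n%:R.
Proof.
move=> n2; have H : \sum_(0 <= k < n) decay 2 (k.+2%:R : R) <= ln n.+1%:R.
  elim: n {n2} => [|n IH]; first by rewrite big_nil ln1.
  rewrite big_nat_recr //= decay2 //.
  have := expR_ge1Dx (- (n.+2%:R : R)^-1) => H.
  have E : 1 - (n.+2%:R : R)^-1 = n.+1%:R / n.+2%:R.
    by rewrite -[n.+1%:R](addrK 1) natr1 mulrBl divff ?pnatr_eq0 // mul1r.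
  move: H; rewrite E -ler_ln ?posrE ?divr_gt0 ?expR_gt0 // expRK ln_div ?posrE //.
  by move=> {}H; apply: le_trans (lerD IH (lexx _)) _; rewrite -lerBrDl -lerN2 opprB.
apply: le_trans H _; rewrite mulr_natl -lnXn ?ltr0n; last by lia.
by rewrite ler_ln ?posrE ?exprn_gt0 ?ltr0n -?natrX ?ler_nat; nia.
Qed.

(** Telescoping with 2 / sqrt (k+1): for consecutive roots s < t, the identity (t - s)(t + s) = 1
    gives t^(-3) <= 2/s - 2/t. *)
Lemma sum_decay3_le n : \sum_(0 <= k < n) decay 3 (k.+2%:R : R) <= 2.
Proof.
suff : \sum_(0 <= k < n) decay 3 (k.+2%:R : R) <= 2 - 2 * (Num.sqrt n.+1%:R)^-1.
  move=> /le_trans; apply; rewrite gerBl mulr_ge0 // invr_ge0; exact: sqrtr_ge0.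
elim: n => [|n IH]; first by rewrite big_nil sqrtr1 invr1; lra.
rewrite big_nat_recr //= /decay.
have s0 : 0 < Num.sqrt (n.+1%:R : R) by rewrite sqrtr_gt0.
have st : Num.sqrt (n.+1%:R : R) <= Num.sqrt n.+2%:R.
  by rewrite ler_sqrt ?ltr0n // ler_nat.
have s2 : Num.sqrt (n.+1%:R : R) ^+ 2 = n.+1%:R by rewrite sqr_sqrtr.
have t2 : Num.sqrt (n.+2%:R : R) ^+ 2 = n.+1%:R + 1 by rewrite sqr_sqrtr // natr1.
move: IH s0 st s2 t2; set S := \sum_(_ <= _ < _) _.
move: (Num.sqrt _) (Num.sqrt n.+2%:R) => s t IH s0 st s2 t2.
have t0 : 0 < t by lra.
have ts : (t - s) * (t + s) = 1 by rewrite -subr_sqr; lra.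
have E : 2 * s^-1 - 2 * t^-1 - t^-1 ^+ 3 =
    (2 * (t - s) * t ^+ 2 - s) / (s * t ^+ 3).
  by field; rewrite !gt_eqF.
have : 0 <= 2 * s^-1 - 2 * t^-1 - t^-1 ^+ 3.
  rewrite E divr_ge0 ?mulr_ge0 ?exprn_ge0 ?(ltW s0) ?(ltW t0) //.
  have : (t + s) * (t - s) * t <= 2 * t * (t - s) * t.
    by rewrite !ler_pM2r // ?subr_gt0; nra.
  nra.
lra.
Qed.

Lemma sum_heat_bound_le d p : exists2 C : R, 0 < C & forall n,
  \sum_(0 <= k < n) heat_bound d p k.+1 <= C * \sum_(0 <= k < n) decay p k.+2%:R.
Proof.
pose r : R := 2 / (2 * d + 1)%:R / 6.
have D1 : 1 <= (2 * d + 1)%:R :> R by rewrite ler1n addn1.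
have r0 : 0 < r by rewrite !divr_gt0 // (lt_le_trans _ D1).
have r1 : r <= 1.
  have : 2 / (2 * d + 1)%:R <= 2 :> R by rewrite ler_pdivrMr ?(lt_le_trans _ D1) //; lra.
  rewrite /r; lra.
(* Since r <= 1, r (k+1) + 1 >= r (k+2), and [decay] is multiplicative. The added 1 keeps the
   constant positive even if d = 0. *)
exists (d%:R * decay p r + 1); first by rewrite ltr_wpDl // mulr_ge0 // decay_ge0.
move=> n; rewrite big_distrr /=; apply: ler_sum => k _.
rewrite /heat_bound -/r mulrDl mul1r -mulrA -decayM ?(ltW r0) //.
apply: (@le_trans _ _ (d%:R * decay p (r * k.+2%:R))); last first.
  by rewrite lerDl decay_ge0.
rewrite ler_wpM2l // ler_decay // ?mulr_gt0 // -[k.+2%:R]natr1 mulrDr mulr1.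
by rewrite lerD2l.
Qed.

End HeatKernel.

(** * Tail bounds *)

Section Events.
Context {R : realType} {dT : measure_display} {T : measurableType dT}.
Variable P : probability T R.
Implicit Types (G : T -> R) (E : set T).

Lemma measurable_ge G (r : R) : measurable_fun setT G -> measurable [set w | r <= G w].
Proof.
move=> mG; have := mG measurableT `[r, +oo[%classic (measurable_itv _).
rewrite setTI (_ : G @^-1` _ = [set w | r <= G w]) //.
by apply/seteqP; split => w /=; rewrite in_itv /= andbT.
Qed.

Lemma fine_probabilityK E : measurable E -> (fine (P E))%:E = P E.
Proof. by move=> mE; rewrite fineK // fin_num_measure. Qed.

(** Markov's inequality after removal of the lower bound [b]. With b = 1 and G = (1 + eta)^U_n(x),
    only the part proportional to A^n 1_x(0) remains on the right, which is summable over x. *)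
Lemma markov_offset G E (b t c : R) : measurable_fun setT G -> measurable E ->
  0 <= b -> 0 <= t -> (forall w, b <= G w) -> (forall w, E w -> b + t <= G w) ->
  (\int[P]_w (G w)%:E <= c%:E)%E -> b + t * fine (P E) <= c.
Proof.
move=> mG mE b0 t0 bG tG Gc; rewrite -lee_fin; apply: le_trans Gc.
have mI : measurable_fun setT (fun w => t * \1_E w : R).
  by apply: measurable_funM => //; exact: measurable_cst.
have -> : ((b + t * fine (P E))%:E = \int[P]_w (b + t * \1_E w)%:E)%E.
  under eq_integral do rewrite EFinD.
  rewrite ge0_integralD //=; last 2 first.
  - by move=> w _; rewrite lee_fin mulr_ge0.
  - exact/measurable_EFinP.
  rewrite (eq_integral (cst b%:E)) // integral_cst //.
  rewrite [X in (_ * X)%E]probability_setT mule1 EFinD.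
  congr (_ + _)%E; under eq_integral do rewrite EFinM.
  rewrite ge0_integralZl_EFin //; last exact/measurable_EFinP.
  by rewrite integral_indic // setIT EFinM fine_probabilityK.
apply: ge0_le_integral => //.
- by move=> w _; rewrite lee_fin addr_ge0 // mulr_ge0.
- apply/measurable_EFinP; apply: measurable_funD => //; exact: measurable_cst.
- exact/measurable_EFinP.
move=> w _; rewrite lee_fin indicE; case: (boolP (w \in E)) => [/set_mem Ew|_].
  by rewrite mulr1 tG.
by rewrite mulr0 addr0.
Qed.

End Events.

Section Bounds.
Context {R : realType} {dT : measure_display} {T : measurableType dT}.
Variables (P : probability T R) (d : nat).
Variables (offspring : label -> {RV P >-> nat})
          (step : label -> {RV P >-> site d}).
Variable Q : nat -> R.
Hypothesis brw : branching_random_walk offspring step Q.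
Local Notation gen := (generation offspring).
Local Notation U := (brw_U offspring step).
Local Notation V := (brw_V offspring step).
Local Notation G_ := (survival offspring).

(** The product of the constant 1 - c over generation n equals 1 exactly on extinction, so its mean
    bounds the extinction probability from above. *)
Lemma survival_ge (a B : R) n : 0 < a -> 0 < B -> quadratic_genfun_bound Q a B ->
  measurable (G_ n) /\
  (2 * (B + 1))^-1 / n.+1%:R <= fine (P (G_ n)).
Proof.
move=> a0 B0 genf; pose c : R := (2 * (B + 1))^-1.
have c0 : 0 < c by rewrite invr_gt0; lra.
have c12 : c <= 1 / 2 by rewrite div1r lef_pV2 ?posrE //; lra.
have cB : c * B <= 1 / 2.
  have : c * (2 * (B + 1)) = 1 by rewrite mulVf // gt_eqF //; lra.
  lra.
pose phi r (_ : site d) : R := 1 + - (c / r.+1%:R).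
have cr r : 0 < c / r.+1%:R <= 1 / 2.
  rewrite divr_gt0 //= ler_pdivrMr //; apply: le_trans c12 _.
  by apply: ler_peMr; [lra|rewrite ler1n].
have phi0 r y : 0 <= phi r y by have := cr r; rewrite /phi; move: (c / _) => z; lra.
have phiS r y s : (r < n)%N -> uniq s ->
    \sum_(l <- s) Q l * avg (phi r) y ^+ l <= phi r.+1 y.
  move=> _ us; rewrite avg_cst; apply: le_trans (genf _ _ _ us) _.
    by have := cr r; move: (c / _) => z; lra.
  rewrite /phi -!addrA lerD2l sqrrN -lerN2 opprD !opprK.
  have x0 : 0 < r.+1%:R :> R by [].
  rewrite -[r.+2%:R]natr1; set x := r.+1%:R in x0 *.
  have x1 : 1 <= x by rewrite /x ler1n.
  rewrite -subr_ge0.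
  have -> : c / x - B * (c / x) ^+ 2 - c / (x + 1) =
    c * (x - c * B * (x + 1)) / (x ^+ 2 * (x + 1)).
    by field; rewrite !gt_eqF //; lra.
  have x10 : 0 <= x + 1 by lra.
  apply: divr_ge0; last by rewrite mulr_ge0 ?sqr_ge0.
  rewrite mulr_ge0 ?(ltW c0) // subr_ge0.
  (* The choice of c makes c B <= 1/2, and (x + 1) / 2 <= x for x >= 1. *)
  have : c * B * (x + 1) <= 1 / 2 * (x + 1) by rewrite ler_wpM2r.
  by move=> /le_trans; apply; lra.
have [mG GE] := mean_generation brw phi0 phiS (leqnn n).
set G := fun w => _ in mG.
have GX w : G w = (1 - c) ^+ size (gen w n).
  by rewrite /G big_const_seq count_predT iter_mulr_1 /phi divr1.
have GnE : G_ n = ~` [set w | 1 <= G w].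
  apply/seteqP; split => w; rewrite /survival /= GX; case: (gen w n) => [|v s] //=.
    by move=> _; apply/negP; rewrite -ltNge exprn_ilt1 //; lra.
have mGn : measurable (G_ n) by rewrite GnE; apply: measurableC; exact: measurable_ge.
split=> //; have mGnC := measurableC mGn.
have := markov_offset (b := 0) (t := 1) mG mGnC (lexx _) ler01 _ _ GE.
rewrite add0r mul1r probability_setC // fineB ?fin_num_measure //=.
rewrite /phi; set x := fine _; set y := c / _ => H.
suff : 0 + (1 - x) <= 1 - y by lra.
apply: H => w; first by rewrite GX exprn_ge0 //; lra.
move=> nG; rewrite ?add0r; apply: contrapT => G1; apply: nG; rewrite GnE => G1'.
exact: G1.
Qed.

Lemma prod_site_indic (eta : R) x n w :
  \prod_(v <- gen w n) (1 + eta * site_indic x (position step w v)) =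
  (1 + eta) ^+ U n x w.
Proof.
rewrite /brw_U; elim: (gen w n) => [|v s IH] /=; first by rewrite big_nil.
rewrite big_cons IH /site_indic exprD; case: (_ == x) => /=.
  by rewrite expr1 mulr1.
by rewrite mulr0 addr0 expr0.
Qed.

Lemma tail_U (a B eta : R) (p n m : nat) x : 0 < a -> 0 < B ->
  quadratic_genfun_bound Q a B -> (2 <= p <= 4)%N -> (p <= d)%N ->
  0 < eta -> 2 * eta <= a ->
  4 * B * eta * \sum_(0 <= k < n) heat_bound d p k.+1 <= 1 ->
  measurable [set w | (m <= U n x w)%N] /\
  ((1 + eta) ^+ m - 1) * fine (P [set w | (m <= U n x w)%N]) <=
    2 * eta * walk n (site_indic x) 0.
Proof.
move=> a0 B0 genf p24 pd e0 ea SB.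
pose S k : R := \sum_(0 <= i < k) heat_bound d p i.+1.
(* The increments of [lam] absorb the quadratic error: lam_k^2 <= 4, and one of the two heat kernel
   factors is replaced by its maximum. *)
pose lam k := 1 + 4 * B * eta * S k.
have Be0 : 0 < B * eta by rewrite mulr_gt0.
have S0 k : 0 <= S k by apply: sumr_ge0 => i _; exact: heat_bound_ge0.
have Sn k : (k <= n)%N -> S k <= S n.
  move=> kn; rewrite /S (big_cat_nat (leq0n k) kn) /= lerDl sumr_ge0 // => i _.
  exact: heat_bound_ge0.
have lam1 k : 1 <= lam k.
  by rewrite /lam lerDl !mulr_ge0 // ltW.
have lam2 k : (k <= n)%N -> lam k <= 2.
  move=> kn; have : 4 * B * eta * S k <= 4 * B * eta * S n.
    by rewrite ler_wpM2l ?Sn // !mulr_ge0 // ltW.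
  by move: SB; rewrite -/(S n) /lam; lra.
pose u k (y : site d) : R := walk k (site_indic x) y.
have si0 (y : site d) : 0 <= site_indic x y :> R by exact: ler0n.
have u0 k y : 0 <= u k y by exact: walk_ge0.
have u1 k y : u k y <= 1.
  by have := sum_walk_indic_le1 (R := R) k y (s := [:: x]) isT; rewrite big_seq1.
pose phi k y := 1 + lam k * eta * u k y.
have phi0 k y : 0 <= phi k y.
  by rewrite addr_ge0 // !mulr_ge0 ?(ltW e0) // (le_trans ler01).
have phiS k y s : (k < n)%N -> uniq s ->
    \sum_(l <- s) Q l * avg (phi k) y ^+ l <= phi k.+1 y.
  move=> kn us; rewrite avg_lin -[avg (u k) y]/(u k.+1 y).
  have l1 := lam1 k; have l2 := lam2 k (ltnW kn).
  have uh := walk_indic_le (R := R) k.+1 x y p24 pd.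
  rewrite -/(u k.+1 y) in uh.
  have uy0 := u0 k.+1 y; have uy1 := u1 k.+1 y.
  have le0 : 0 <= lam k * eta by rewrite mulr_ge0 ?(ltW e0) // (le_trans ler01).
  have v0 : 0 <= lam k * eta * u k.+1 y by exact: mulr_ge0.
  have va : lam k * eta * u k.+1 y <= a.
    apply: le_trans ea; rewrite -[leRHS]mulr1; apply: ler_pM => //.
    by rewrite ler_wpM2r // ltW.
  apply: le_trans (genf _ _ _ us) _; first by rewrite va andbT (le_trans _ v0) // lerN10.
  rewrite /phi -addrA lerD2l /lam /S big_nat_recr //= -/(S k) -/(lam k).
  set h := heat_bound _ _ _ in uh *.
  rewrite -![avg (u k) y]/(u k.+1 y).
  move: (u k.+1 y) uh uy0 uy1 v0 va => z uh uy0 uy1 v0 va.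
  have -> : (1 + 4 * B * eta * (S k + h)) * eta * z =
      lam k * eta * z + 4 * B * eta * h * eta * z by rewrite /lam; ring.
  rewrite lerD2l.
  have -> : B * (lam k * eta * z) ^+ 2 = lam k ^+ 2 * z * (B * eta * eta * z) by ring.
  have -> : 4 * B * eta * h * eta * z = 4 * h * (B * eta * eta * z) by ring.
  apply: ler_wpM2r; first by rewrite !mulr_ge0 // ltW.
  apply: ler_pM => //; first exact: sqr_ge0.
  nra.
have [mG GE] := mean_generation brw phi0 phiS (leqnn n).
have phi0E y : phi 0%N y = 1 + eta * site_indic x y.
  by rewrite /phi /lam /S big_nil mulr0 addr0 mul1r.
set G := fun w => _ in mG.
have GX w : G w = (1 + eta) ^+ U n x w.
  by rewrite -prod_site_indic; apply: eq_bigr => v _; rewrite phi0E.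
have e1 : 1 < 1 + eta by rewrite ltrDl.
have EG : [set w | (m <= U n x w)%N] = [set w | (1 + eta) ^+ m <= G w].
  by apply/seteqP; split => w /=; rewrite GX ler_eXn2l.
have mE : measurable [set w | (m <= U n x w)%N] by rewrite EG; exact: measurable_ge.
split=> //; have t0 : 0 <= (1 + eta) ^+ m - 1 by rewrite subr_ge0 exprn_ege1 // ltW.
have := markov_offset (b := 1) mG mE ler01 t0 _ _ GE.
rewrite /phi -/(u n 0) => H.
have : 1 + ((1 + eta) ^+ m - 1) * fine (P [set w | (m <= U n x w)%N])
    <= 1 + lam n * eta * u n 0.
  apply: H => w; first by rewrite GX exprn_ege1 // ltW.
  by rewrite EG /= subrKC.
rewrite lerD2l => /le_trans; apply; rewrite ler_wpM2r // ler_wpM2r ?lam2 //.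
exact: ltW.
Qed.

(** As [m] is the least natural number above [t], V_n exceeds [t] exactly when some U_n(x) reaches
    [m]; a union bound over sites follows. *)
Lemma tail_V (a B eta t : R) (p n m : nat) : 0 < a -> 0 < B ->
  quadratic_genfun_bound Q a B -> (2 <= p <= 4)%N -> (p <= d)%N ->
  0 < eta -> 2 * eta <= a ->
  4 * B * eta * \sum_(0 <= k < n) heat_bound d p k.+1 <= 1 ->
  0 <= t -> (Num.trunc t).+1 = m ->
  measurable [set w | t < V n w] /\
  ((1 + eta) ^+ m - 1) * fine (P [set w | t < V n w]) <= 2 * eta.
Proof.
move=> a0 B0 genf p24 pd e0 ea SB t0 mE.
have tU x := tail_U m x a0 B0 genf p24 pd e0 ea SB.
pose E x := [set w | (m <= U n x w)%N].
pose D : R := (1 + eta) ^+ m - 1.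
have D0 : 0 < D by rewrite subr_gt0 exprn_egt1 -?mE // ltrDl.
pose S : countType := 'rV[int]_d.
pose F k := if @pickle_inv S k is Some x then E x else set0.
have mF k : measurable (F k).
  by rewrite /F; case: (pickle_inv k) => [x|] //; have [] := tU x.
have VF : [set w | t < V n w] = \bigcup_k F k.
  apply/seteqP; split => [w /= tV|w [k _]].
    have [[x VE] _] := brw_V_max offspring step n w.
    exists (@pickle S x) => //; rewrite /F pickleK_inv /E /=.
    by rewrite -mE truncn_lt_nat // -VE.
  rewrite /F; case: (pickle_inv k) => [x|] //=; rewrite /E /= -mE truncn_lt_nat // => tx.
  by have [_ /(_ x)] := brw_V_max offspring step n w; exact: lt_le_trans.
have mV : measurable [set w | t < V n w] by rewrite VF; exact: bigcup_measurable.
split=> //; rewrite -/D mulrC -ler_pdivlMr // -lee_fin fine_probabilityK // VF.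
apply: le_trans (generalized_Boole_inequality P mF _) _; first by rewrite -VF.
apply: (nneseries_countable_le (V := S)
  (a := fun x => 2 * eta / D * walk n (site_indic x) 0)) => //.
  move=> k; rewrite /F; case: (pickle_inv k) => [x|]; last by rewrite measure0.
  have [mx] := tU x; rewrite -/D => Ux.
  apply: (@le_trans _ _ (fine (P (E x)))%:E); first by rewrite fine_probabilityK.
  by rewrite lee_fin mulrAC ler_pdivlMr // mulrC.
move=> s us; rewrite -big_distrr /= -[leRHS]mulr1 ler_wpM2l //.
  by apply: divr_ge0; rewrite ?mulr_ge0 // ltW.
exact: sum_walk_indic_le1.
Qed.

End Bounds.

(** * Tightness *)

Section Tightness.
Context {R : realType} {dT : measure_display} {T : measurableType dT}.
Variables (P : probability T R) (d : nat).
Variables (offspring : label -> {RV P >-> nat})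
          (step : label -> {RV P >-> site d}).

(** From exp(-x/2) >= 1 - x/2 and (1 - x/2)(1 + x) >= 1 on [0, 1]. *)
Lemma expR_half_le (x : R) : 0 <= x <= 1 -> expR (x / 2) <= 1 + x.
Proof.
move=> x01; have := expR_ge1Dx (- (x / 2)); rewrite expRN => H.
have e0 := expR_gt0 (x / 2); move: (expR _) e0 H => e e0 H.
have : (1 + - (x / 2)) * e <= 1.
  by rewrite -[leRHS](mulVf (lt0r_neq0 e0)) ler_wpM2r // ltW.
nra.
Qed.

Lemma expr_le_expr1D (n j m : nat) (eta t : R) : (0 < n)%N -> 0 <= eta <= 1 ->
  j%:R * ln n%:R <= t * (eta / 2) -> t <= m%:R ->
  n%:R ^+ j <= (1 + eta) ^+ m.
Proof.
move=> n0 e01 jt tm; have /andP[e0 _] := e01.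
apply: (@le_trans _ _ (expR (eta / 2) ^+ m)); last first.
  by apply: lerXn2r; rewrite ?nnegrE ?expR_ge0 ?addr_ge0 // expR_half_le.
have -> : n%:R = expR (ln n%:R) :> R by rewrite lnK // posrE ltr0n.
rewrite -!expRM_natl ler_expR; apply: le_trans jt _.
by rewrite ler_wpM2r // divr_ge0.
Qed.

Lemma natrS_le_expr (eps : R) : 0 < eps -> exists j : nat, forall n, (2 <= n)%N ->
  n.+1%:R <= eps * (n%:R ^+ j - 1).
Proof.
move=> e0; have ei0 : 0 <= eps^-1 by rewrite invr_ge0 ltW.
have [i ei] : exists i : nat, eps^-1 <= 2 ^+ i.
  exists (Num.bound eps^-1); apply: le_trans (ltW (archi_boundP ei0)) _.
  by rewrite -natrX ler_nat ltnW // ltn_expl.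
(* The power n^i beats 1 / eps, and n^2 beats n + 1 with enough room for the subtracted 1. *)
exists (i + 2)%N => n n2; have n2R : 2 <= n%:R :> R by rewrite ler_nat.
rewrite mulrC -ler_pdivrMr // exprD.
apply: (@le_trans _ _ (n.+1%:R * 2 ^+ i)); first by rewrite ler_wpM2l.
have : 2 ^+ i <= n%:R ^+ i :> R by rewrite lerXn2r // nnegrE //; lra.
have : 1 <= 2 ^+ i :> R by rewrite exprn_ege1 //; lra.
rewrite -[n.+1%:R]natr1; 
move: (n%:R) n2R (2 ^+ i) (n%:R ^+ i) => z z2 x y x1 xy.
have : x * z ^+ 2 <= y * z ^+ 2 by rewrite ler_wpM2r // sqr_ge0.
have : 0 <= x * ((z - 2) * (z + 1)) by rewrite !mulr_ge0 //; lra.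
nra.
Qed.

Lemma conditional_distribution_le (H E : set T) (X : T -> R) (A : set R) (p : R) :
  measurable E -> measurable H -> X @^-1` A = E -> 0 < p -> p <= fine (P H) ->
  conditional_distribution P H X A <= fine (P E) / p.
Proof.
move=> mE mH XE p0 pH; rewrite /conditional_distribution XE.
apply: ler_pM; rewrite ?invr_ge0 ?fine_ge0 //.
  rewrite fine_le ?fin_num_measure //; first exact: measurableI.
  by apply: le_measure; rewrite ?inE //; exact: measurableI.
by rewrite lef_pV2 // posrE // (lt_le_trans p0).
Qed.

(** Here [h] is the growth of the summed heat kernel maxima. It dictates eta of order 1 / h n, hence
    the scale (log n) / eta for V_n. *)
Lemma tight_V (Q : nat -> R) (p : nat) (h : nat -> R) (C h0 : R) :
  is_distribution Q -> distribution_mean Q = 1%E -> exponential_tail Q ->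
  branching_random_walk offspring step Q ->
  (2 <= p <= 4)%N -> (p <= d)%N -> 0 < C -> 0 < h0 ->
  (forall n, (2 <= n)%N -> h0 <= h n) ->
  (forall n, (2 <= n)%N -> \sum_(0 <= k < n) heat_bound d p k.+1 <= C * h n) ->
  bigO_P_given P [set n | (2 <= n)%N] (brw_V offspring step)
    (fun n => h n * ln n%:R) (survival offspring).
Proof.
move=> [Q0 Q1] mQ tQ brw p24 pd C0 h00 hh0 hC eps eps0.
have [a a0 [B B0 genf]] := generating_function_le (conj Q0 Q1) mQ tQ.
(* The three summands secure, in turn, the smallness of eta times the kernel sum, 2 eta <= a, and 2
   eta <= 1. *)
pose D : R := 4 * B * C + 2 / (a * h0) + 2 / h0.
have D1 : 0 < 4 * B * C by rewrite !mulr_gt0.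
have D2 : 0 < 2 / (a * h0) by rewrite divr_gt0 // mulr_gt0.
have D3 : 0 < 2 / h0 by rewrite divr_gt0.
have D0 : 0 < D by rewrite /D !addr_gt0.
pose s0 : R := (2 * (B + 1))^-1.
have s00 : 0 < s0 by rewrite invr_gt0 mulr_gt0 // addr_gt0.
have [j jP] := natrS_le_expr (mulr_gt0 eps0 s00).
(* Chosen so that t eta / 2 = j ln n for the threshold [t] below; then (1 + eta)^m >= n^j. *)
pose K : R := 2 * j%:R * D.
have K0 : 0 <= K by rewrite !mulr_ge0 // ltW.
exists `[0, K]%classic; first exact: segment_compact.
move=> n /= n2; have hn0 : 0 < h n by exact: lt_le_trans (hh0 _ n2).
have ln0 : 0 < ln n%:R :> R by rewrite ln_gt0 // ltr1n.
pose eta := (D * h n)^-1.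
have Dh0 : 0 < D * h n by rewrite mulr_gt0.
have e0 : 0 < eta by rewrite invr_gt0.
have eP x : x <= D * h n -> eta * x <= 1.
  by move=> xD; rewrite mulrC ler_pdivrMr // mul1r.
have ea : 2 * eta <= a.
  have : eta * (2 / a) <= 1.
    apply: eP; apply: (@le_trans _ _ (2 / (a * h0) * h0)).
      by rewrite invfM mulrA divfK // gt_eqF.
    apply: ler_pM; rewrite ?(ltW D2) ?(ltW h00) ?hh0 // /D; lra.
  by rewrite mulrA ler_pdivrMr // mul1r mulrC.
have e1 : 2 * eta <= 1.
  rewrite mulrC; apply: eP; apply: (@le_trans _ _ (2 / h0 * h0)).
    by rewrite divfK // gt_eqF.
  by apply: ler_pM; rewrite ?(ltW D3) ?(ltW h00) ?hh0 // /D; lra.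
have SB : 4 * B * eta * \sum_(0 <= k < n) heat_bound d p k.+1 <= 1.
  apply: (@le_trans _ _ (4 * B * eta * (C * h n))).
    by rewrite ler_wpM2l ?hC // !mulr_ge0 // ltW.
  rewrite (_ : _ * _ = eta * (4 * B * C * h n)); last by ring.
  by apply: eP; rewrite ler_wpM2r ?(ltW hn0) // /D; lra.
pose t := K * (h n * ln n%:R).
have t0 : 0 <= t by rewrite !mulr_ge0 // ltW.
have [mV VP] := tail_V brw a0 B0 genf p24 pd e0 ea SB t0 erefl.
have [mG GP] := survival_ge brw n a0 B0 genf.
set E := [set w | t < brw_V offspring step n w] in mV VP.
have hl0 : 0 < h n * ln n%:R by rewrite mulr_gt0.
have XE : (fun w => brw_V offspring step n w / (h n * ln n%:R)) @^-1`
    (~` `[0, K]%classic) = E.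
  apply/seteqP; split => w /=; rewrite in_itv /= /E /= /t.
    move=> /negP; rewrite negb_and -!ltNge => /orP[|]; last by rewrite ltr_pdivlMr.
    rewrite ltr_pdivrMr // mul0r => V0.
    have [_ /(_ 0)] := brw_V_max offspring step n w.
    by move=> /le_lt_trans /(_ V0); rewrite ltNge ler0n.
  move=> tV; apply/negP; rewrite negb_and -!ltNge; apply/orP; right.
  by rewrite ltr_pdivlMr.
apply: le_trans (conditional_distribution_le mV mG XE _ GP) _.
  exact: divr_gt0.
rewrite ler_pdivrMr ?divr_gt0 //.
have e01 : 0 <= eta <= 1.
  by rewrite (ltW e0) (le_trans _ e1) // ler_peMl ?ler1n // ltW.
have nj : n%:R ^+ j <= (1 + eta) ^+ (Num.trunc t).+1.
  apply: (expr_le_expr1D (ltnW n2) e01 _ (ltW (truncnS_gt t))).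
  rewrite (_ : t * _ = D * h n * eta * (j%:R * ln n%:R)).
    by rewrite /eta divff ?mul1r // gt_eqF.
  by rewrite /t /K; field.
have F0 : 0 <= fine (P E) by rewrite fine_ge0.
have n0 : 0 < n.+1%:R :> R by [].
(* By the choice of [j], the tail bound beats the factor n + 1 lost by conditioning on survival. *)
rewrite mulrA ler_pdivlMr // mulrC.
apply: le_trans (ler_wpM2r F0 (jP _ n2)) _; rewrite -mulrA ler_piMr //.
  by rewrite mulr_ge0 // ltW.
apply: le_trans e1; apply: le_trans VP; rewrite ler_wpM2r //.
by rewrite lerD2r.
Qed.

End Tightness.

Unset Implicit Arguments.

Theorem theorem3 (R : realType) (dT : measure_display)
    (T : measurableType dT) (P : probability T R) (d : nat) (Q : nat -> R)
    (offspring : label -> {RV P >-> nat})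
    (step : label -> {RV P >-> site d}) :
  is_distribution Q ->
  distribution_mean Q = 1%E ->
  (0 < distribution_variance Q < +oo)%E ->
  branching_random_walk offspring step Q ->
  exponential_tail Q ->
  ((3 <= d)%N ->
     bigO_P_given P [set n | (2 <= n)%N] (brw_V offspring step)
       (fun n => ln n%:R) (survival offspring)) /\
  (d = 2%N ->
     bigO_P_given P [set n | (2 <= n)%N] (brw_V offspring step)
       (fun n => (ln n%:R) ^+ 2) (survival offspring)).
Proof.
move=> dQ mQ _ brw tQ; split=> [d3|d2].
  (* The decay n^(-3/2) is available in every dimension d >= 3 and is summable, so h = 1. *)
  have [C C0 hC] := @sum_heat_bound_le R d 3.
  have -> : (fun n => ln n%:R) = (fun n => 1 * ln n%:R) :> (nat -> R).
    by apply: funext => n; rewrite mul1r.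
  apply: (tight_V (p := 3) (h := fun=> 1) (C := C * 2) (h0 := 1) dQ mQ tQ brw) => //.
    by rewrite mulr_gt0.
  move=> n _; apply: le_trans (hC n) _; rewrite mulr1 ler_wpM2l ?(ltW C0) //.
  exact: sum_decay3_le.
(* In the plane the kernel decays like 1/n, so h = ln n, which produces the square of the
   logarithm. *)
have [C C0 hC] := @sum_heat_bound_le R d 2.
have ln2 : 0 < ln 2 :> R by rewrite ln_gt0 // ltr1n.
apply: (tight_V (p := 2) (h := fun n => ln n%:R) (C := C * 2) (h0 := ln 2)
  dQ mQ tQ brw) => //.
- by rewrite d2.
- by rewrite mulr_gt0.
- by move=> n n2; rewrite ler_ln ?posrE ?ltr0n ?ler_nat //; lia.
- move=> n n2; apply: le_trans (hC n) _; rewrite -mulrA ler_wpM2l ?(ltW C0) //.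
  exact: sum_decay2_le.
Qed.
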